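(* Let $(Y,S,\gamma)$ be a deterministic machine with update function $f\colon Y\times S\to Y$ (so $\gamma(\cdot\mid y,s)=\delta_{f(y,s)}$), and let $(H,\psi_H,\kappa)$ be a consistent Bayesian filtering interpretation of $\gamma$. Fix $n\ge 1$. For $y\in Y$ let $\psi_{S^n,H_n}(\cdot\mid y)\in P(S^n\times H)$ be the joint law of $((s_1,\dots,s_n),h_n)$ under the process: $h_0\sim\psi_H(\cdot\mid y)$ and, for $k=1,\dots,n$, $(h_k,s_k)\sim\kappa(\cdot\mid h_{k-1})$ (each step conditionally on the previous hidden state). Let $\psi_{S^n}(\cdot\mid y)$ be its marginal on $S^n$, and let $f^n\colon Y\times S^n\to Y$ be the iterated update $f^n(y,(s_1,\dots,s_n))=f(\cdots f(f(y,s_1),s_2)\cdots,s_n)$. Then for every $y\in Y$ and all measurable $A\subseteq S^n$, $C\subseteq H$, $$\psi_{S^n,H_n}(A\times C\mid y)=\int_A\psi_H\big(C\mid f^n(y,\mathbf{s})\big)\,\psi_{S^n}(d\mathbf{s}\mid y),$$ i.e. the kernel $(y,\mathbf{s})\mapsto\psi_H(\cdot\mid f^n(y,\mathbf{s}))$ is a conditional (disintegration) of $\psi_{S^n,H_n}$ with respect to $S^n$.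
   Context: All measurable spaces are standard Borel; $P(X)$ denotes probability measures on $X$; a Markov kernel $k\colon X\to P(Z)$ is a measurable map, written $k(E\mid x)$. A machine $(Y,S,\gamma)$ consists of measurable spaces $Y,S$ and a Markov kernel $\gamma\colon Y\times S\to P(Y)$. Given a measurable space $H$ and Markov kernels $\psi_H\colon Y\to P(H)$, $\kappa\colon H\to P(H\times S)$, define $\psi_{S,H'}(E\mid y)=\int_H\kappa(E\mid h)\,\psi_H(dh\mid y)$ for measurable $E\subseteq H\times S$, and $\psi_S(A\mid y)=\psi_{S,H'}(H\times A\mid y)$. The triple $(H,\psi_H,\kappa)$ is a consistent Bayesian filtering interpretation of $\gamma$ if for all $y\in Y$ and measurable $C\subseteq H$, $A\subseteq S$, $B\subseteq Y$: $$\int_{C\times A}\gamma(B\mid y,s)\,\psi_{S,H'}(dh',ds\mid y)=\int_A\int_B\psi_H(C\mid y')\,\gamma(dy'\mid y,s)\,\psi_S(ds\mid y).$$ *)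

(* Defs.v *)
From HB Require Import structures.
From mathcomp Require Import all_boot all_order all_algebra.
From mathcomp Require Import all_classical all_reals all_analysis.
Set Implicit Arguments. Unset Strict Implicit. Unset Printing Implicit Defensive.

Definition iter_update {Y S : Type} (f : Y * S -> Y) (y : Y) (ss : seq S) : Y :=
  foldl (fun y' s => f (y', s)) y ss.

(* Main.v *)
Require Import Defs.
From HB Require Import structures.
From mathcomp Require Import all_boot all_order all_algebra.
From mathcomp Require Import all_classical all_reals all_analysis.
From mathcomp Require Import measurable_realfun.
Set Implicit Arguments. Unset Strict Implicit. Unset Printing Implicit Defensive.
Import Order.TTheory GRing.Theory Num.Theory.
Local Open Scope classical_set_scope.
Local Open Scope ring_scope.
Local Open Scope ereal_scope.

(* For a deterministic machine, consistency says that psi_{S,H'}(.|y), read as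
   a law of (s, h'), draws s from psi_S(.|y) and then h' from psi_H(.|f(y,s)):
   both descriptions agree on rectangles, hence everywhere.  By induction on k,
   the law of ((s_1,...,s_k), h_k) draws t = (s_1,...,s_k) from its marginal
   and then h_k from psi_H(.|f^k(y,t)): one more step of kappa from such an h_k
   is, by the previous fact at the point f^k(y,t), a signal s followed by a
   hidden state of law psi_H(.|f(f^k(y,t),s)) = psi_H(.|f^(k+1)(y,ts)).  Laws
   of this two-stage kind are the [mixture]s of a measure with a kernel. *)

Lemma measurableT_preimage d1 d2 (T1 : measurableType d1) (T2 : measurableType d2)
    (g : T1 -> T2) (E : set T2) :
  measurable_fun [set: T1] g -> measurable E -> measurable (g @^-1` E).
Proof. by move=> mg mE; rewrite -[X in measurable X]setTI; exact: mg. Qed.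

Lemma eq_measure_rectangles d1 d2 (T1 : measurableType d1)
    (T2 : measurableType d2) (R : realType)
    (m1 m2 : {measure set (T1 * T2) -> \bar R}) :
  m1 [set: T1 * T2] < +oo ->
  (forall A B, measurable A -> measurable B -> m1 (A `*` B) = m2 (A `*` B)) ->
  forall E, measurable E -> m1 E = m2 E.
Proof.
move=> m1T m12; pose C : set (set (T1 * T2)) :=
  [set C | exists A, measurable A /\ exists B, measurable B /\ C = A `*` B].
have CI : setI_closed C.
  move=> /= _ _ [X1 [mX1 [X2 [mX2 ->]]]] [Y1 [mY1 [Y2 [mY2 ->]]]].
  rewrite -setXI; exists (X1 `&` Y1); split; first exact: measurableI.
  by exists (X2 `&` Y2); split => //; exact: measurableI.
apply: (measure_unique C (fun _ => setT)) => //.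
- rewrite measurable_prod_measurableType; congr (<<s _ >>).
  rewrite predeqE; split => [[A mA [B mB <-]]|[A [mA [B [mB ->]]]]].
    by exists A; split => //; exists B.
  by exists A => //; exists B.
- by move=> _; exists setT; split => //; exists setT; rewrite setXTT.
- by rewrite bigcup_const.
- by move=> _ [A [mA [B [mB ->]]]]; exact: m12.
Qed.

Definition xsection_measurable d1 d2 (T1 : measurableType d1)
    (T2 : measurableType d2) (R : realType)
    (rho : T1 -> {measure set T2 -> \bar R}) :=
  forall E, measurable E -> measurable_fun [set: T1] (fun t => rho t (xsection E t)).

Section mixture.
Context d1 d2 (T1 : measurableType d1) (T2 : measurableType d2) (R : realType).
Variables (mu : {measure set T1 -> \bar R}) (rho : T1 -> {measure set T2 -> \bar R}).
Hypothesis mrho : xsection_measurable rho.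

Let mixture_fun (E : set (T1 * T2)) := \int[mu]_t rho t (xsection E t).

Let mixture0 : mixture_fun set0 = 0.
Proof.
by rewrite /mixture_fun; under eq_integral do rewrite xsection0 measure0; exact: integral0.
Qed.

Let mixture_ge0 E : 0 <= mixture_fun E.
Proof. exact: integral_ge0. Qed.

Let mixture_sigma_additive : semi_sigma_additive mixture_fun.
Proof.
move=> F mF tF mUF.
have -> : mixture_fun (\bigcup_n F n) = \sum_(0 <= n <oo) mixture_fun (F n).
  rewrite /mixture_fun -integral_nneseries//; last by move=> n; exact: mrho.
  apply: eq_integral => t _; rewrite xsection_bigcup.
  apply/esym/cvg_lim => //; apply: measure_semi_sigma_additive.
  - by move=> n; exact: measurable_xsection.
  - exact: trivIset_xsection.
  - by rewrite -xsection_bigcup; exact: measurable_xsection.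
exact: is_cvg_nneseries.
Qed.

Definition mixture : {measure set (T1 * T2) -> \bar R} :=
  HB.pack mixture_fun
    (isMeasure.Build _ _ _ mixture_fun mixture0 mixture_ge0 mixture_sigma_additive).

Lemma mixtureE E : mixture E = \int[mu]_t rho t (xsection E t).
Proof. by []. Qed.

Lemma mixtureX A B : measurable A ->
  mixture (A `*` B) = \int[mu]_(t in A) rho t B.
Proof.
move=> mA; rewrite mixtureE [RHS]integral_mkcond; apply: eq_integral => t _.
rewrite patchE; case: ifPn => tA; first by rewrite in_xsectionX.
by rewrite notin_xsectionX// measure0.
Qed.

End mixture.

Lemma integral_scaled_indic d (T : measurableType d) (R : realType)
    (m : {measure set T -> \bar R}) (E : R -> set T) (r : R) :
  ((r < 0)%R -> E r = set0) -> measurable (E r) ->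
  \int[m]_z (r * \1_(E r) z)%:E = r%:E * m (E r).
Proof. by move=> E0 mE; rewrite integralZl_indic// integral_indic// setIT. Qed.

Section integral_mixture.
Context d1 d2 (T1 : measurableType d1) (T2 : measurableType d2) (R : realType).
Variables (mu : {measure set T1 -> \bar R}) (rho : T1 -> {measure set T2 -> \bar R}).
Hypothesis mrho : xsection_measurable rho.

Import HBNNSimple.

Lemma measurable_fun_integral_xsection (h : T1 * T2 -> \bar R) :
  (forall z, 0 <= h z) -> measurable_fun [set: T1 * T2] h ->
  measurable_fun [set: T1] (fun t => \int[rho t]_s h (t, s)).
Proof.
move=> h0 mh; pose h_ := nnsfun_approx measurableT mh.
apply: (@measurable_fun_xsection_integral _ _ _ _ _ h rho h_).
- by move=> a b ab; exact/nd_nnsfun_approx.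
- by move=> z; exact/cvg_nnsfun_approx.
- by move=> n r; apply: mrho.
Qed.

Let indic_xsection (E : set (T1 * T2)) t :
  (fun s => \1_E (t, s)) = \1_(xsection E t) :> (T2 -> R).
Proof. by apply/funext => s; rewrite !indicE mem_xsection. Qed.

Let integral_scaled_indic_section (E : R -> set (T1 * T2)) r t :
  ((r < 0)%R -> E r = set0) -> measurable (E r) ->
  \int[rho t]_s (r * \1_(E r) (t, s))%:E = r%:E * rho t (xsection (E r) t).
Proof.
move=> E0 mE; rewrite (eq_integral (fun s => (r * \1_(xsection (E r) t) s)%:E)); last first.
  by move=> s _; rewrite -(indic_xsection (E r) t).
apply: (integral_scaled_indic _ (E := fun r => xsection (E r) t)).
- by move=> /E0 ->; rewrite xsection0.
- exact: measurable_xsection.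
Qed.

Let integral_mixture_nnsfun (h : {nnsfun (T1 * T2) >-> R}) :
  \int[mixture mu mrho]_z (h z)%:E = \int[mu]_t \int[rho t]_s (h (t, s))%:E.
Proof.
pose A r := h @^-1` [set r].
have A0 r : (r < 0)%R -> A r = set0 by exact: preimage_nnfun0.
have At0 r t : (r < 0)%R -> xsection (A r) t = set0 by move=> /A0 ->; rewrite xsection0.
have mA r : measurable (A r) by exact: measurable_funPTI.
have inner t : \int[rho t]_s (h (t, s))%:E =
    \sum_(r \in range h) r%:E * rho t (xsection (A r) t).
  under eq_integral do rewrite fimfunE -fsumEFin//.
  rewrite ge0_integral_fsum//; last 2 first.
  - move=> r; apply/measurable_EFinP/measurable_funM => //.
    by rewrite indic_xsection; exact/measurable_indic/measurable_xsection.
  - by move=> r s _; rewrite EFinM nnfun_muleindic_ge0.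
  by apply: eq_fsbigr => r _; apply: (integral_scaled_indic_section (E := A)) => //; exact: A0.
under [in RHS]eq_integral do rewrite inner.
under [in LHS]eq_integral do rewrite fimfunE -fsumEFin//.
rewrite ge0_integral_fsum//; last 2 first.
- by move=> r; apply/measurable_EFinP/measurable_funM => //; exact: measurable_indic.
- by move=> r z _; rewrite EFinM nnfun_muleindic_ge0.
rewrite ge0_integral_fsum//; last 2 first.
- by move=> r; apply: measurable_funeM; exact: mrho.
- by move=> r t _; apply: (mulemu_ge0 (fun r => xsection (A r) t)); exact: At0.
apply: eq_fsbigr => r _.
transitivity (r%:E * mixture mu mrho (A r)).
  by apply: (integral_scaled_indic _ (E := A)) => //; exact: A0.
rewrite mixtureE.
have [r0|r0] := leP 0%R r; first by rewrite ge0_integralZl//; exact: mrho.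
rewrite !integral0_eq ?mule0// => t _; rewrite At0// measure0 ?mule0//.
Qed.

Lemma integral_mixture (h : T1 * T2 -> \bar R) :
  (forall z, 0 <= h z) -> measurable_fun [set: T1 * T2] h ->
  \int[mixture mu mrho]_z h z = \int[mu]_t \int[rho t]_s h (t, s).
Proof.
move=> h0 mh; pose h_ := nnsfun_approx measurableT mh.
have h_nd z m n : (m <= n)%N -> (h_ m z)%:E <= (h_ n z)%:E.
  by move=> mn; rewrite lee_fin; exact/lefP/nd_nnsfun_approx.
have h_lim z : lim ((h_ n z)%:E @[n --> \oo]) = h z.
  by apply/cvg_lim => //; exact: cvg_nnsfun_approx.
have mh_ n : measurable_fun [set: T1 * T2] (fun z => (h_ n z)%:E).
  exact/measurable_EFinP.
have mh_t n t : measurable_fun [set: T2] (fun s => (h_ n (t, s))%:E).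
  exact: measurableT_comp (mh_ n) (pair1_measurable t).
rewrite (eq_integral (fun z => lim ((h_ n z)%:E @[n --> \oo]))); last first.
  by move=> z _; rewrite h_lim.
rewrite monotone_convergence//; last 2 first.
- by move=> n z _; rewrite lee_fin.
- by move=> z _ m n; exact: h_nd.
under eq_fun do rewrite integral_mixture_nnsfun.
rewrite -monotone_convergence//; last 3 first.
- move=> n; apply: (measurable_fun_integral_xsection (h := fun z => (h_ n z)%:E)).
  + by move=> z; rewrite lee_fin.
  + exact: mh_.
- by move=> n t _; apply: integral_ge0 => s _; rewrite lee_fin.
- move=> t _ m n mn; apply: ge0_le_integral => //; first by move=> s _; rewrite lee_fin.
  by move=> s _; exact: h_nd.
apply: eq_integral => t _; rewrite -monotone_convergence//; last 2 first.
- by move=> n s _; rewrite lee_fin.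
- by move=> s _ m n; exact: h_nd.
by apply: eq_integral => s _; rewrite h_lim.
Qed.
End integral_mixture.

Lemma ge0_integral_image d1 d2 (X : measurableType d1) (Y : measurableType d2)
    (R : realType) (phi : X -> Y) (mu : {measure set X -> \bar R})
    (nu : {measure set Y -> \bar R}) (g : Y -> \bar R) :
  measurable_fun [set: X] phi ->
  (forall A, measurable A -> nu A = mu (phi @^-1` A)) ->
  (forall y, 0 <= g y) -> measurable_fun [set: Y] g ->
  \int[nu]_y g y = \int[mu]_x g (phi x).
Proof.
move=> mphi numu g0 mg.
transitivity (\int[mu]_(x in phi @^-1` setT) (g \o phi) x); last by [].
rewrite -(ge0_integral_pushforward mphi)//.
by apply: eq_measure_integral => A mA _; exact: numu.
Qed.

Section kernel_precomp.
Context d dY dZ (T : measurableType d) (Y : measurableType dY)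
  (Z : measurableType dZ) (R : realType).
Variables (K : R.-fker Y ~> Z) (g : T -> Y).
Hypothesis mg : measurable_fun [set: T] g.

(* The unused argument puts the measurability proof into the term, so that the
   kernel instances below can be found by unification. *)
Definition kernel_precomp (_ : measurable_fun [set: T] g) (t : T) := K (g t).

Let measurable_kernel_precomp U : measurable U ->
  measurable_fun [set: T] (kernel_precomp mg ^~ U).
Proof. by move=> mU; exact: measurableT_comp (measurable_kernel K U mU) mg. Qed.

HB.instance Definition _ :=
  isKernel.Build _ _ _ _ _ (kernel_precomp mg) measurable_kernel_precomp.

Let kernel_precomp_uub : measure_fam_uub (kernel_precomp mg).
Proof. by have [r Kr] := measure_uub K; exists r => t; exact: Kr. Qed.

HB.instance Definition _ :=
  Kernel_isFinite.Build _ _ _ _ _ (kernel_precomp mg) kernel_precomp_uub.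

Lemma xsection_measurable_comp : xsection_measurable (fun t => K (g t)).
Proof.
move=> E mE; have := @measurable_fun_xsection_finite_kernel _ _ _ _ _ (kernel_precomp mg) E.
by rewrite inE; apply.
Qed.

End kernel_precomp.

Section tuple_measurable.
Context d (S : measurableType d).

Lemma measurable_rcons_tuple k :
  measurable_fun [set: k.-tuple S * S] (fun p => [tuple of rcons p.1 p.2]).
Proof.
apply/measurable_fun_tnthP => i /=.
have [ik|ik] := ltnP i k.
- rewrite (_ : _ \o _ = (fun p => tnth p.1 (Ordinal ik))).
    exact: measurableT_comp (measurable_tnth _) measurable_fst.
  apply/funext => p /=; rewrite (tnth_nth p.2) /= nth_rcons size_tuple ik.
  by rewrite (tnth_nth p.2).
- have ik' : val i = k by apply/eqP; rewrite eqn_leq ik andbT -ltnS ltn_ord.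
  rewrite (_ : _ \o _ = snd) //; apply/funext => p /=.
  by rewrite (tnth_nth p.2) /= nth_rcons size_tuple ik' ltnn eqxx.
Qed.

Lemma measurable_rcons_tuple1 k (t : k.-tuple S) :
  measurable_fun [set: S] (fun s => [tuple of rcons t s]).
Proof.
have := measurableT_comp (@measurable_rcons_tuple k) (pair1_measurable t); exact.
Qed.

Context dY (Y : measurableType dY) (f : Y * S -> Y).
Hypothesis mf : measurable_fun [set: Y * S] f.

Lemma iter_update_rcons y (ss : seq S) s :
  iter_update f y (rcons ss s) = f (iter_update f y ss, s).
Proof. exact: foldl_rcons. Qed.

Lemma measurable_iter_update k :
  measurable_fun [set: Y * k.-tuple S] (fun p => iter_update f p.1 p.2).
Proof.
elim: k => [|k IH].
  by rewrite (_ : (fun _ => _) = fst) //; apply/funext => -[y t] /=; rewrite tuple0.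
rewrite (_ : (fun _ => _) = (fun p : Y * k.-tuple S => iter_update f p.1 p.2) \o
   (fun p : Y * k.+1.-tuple S => (f (p.1, thead p.2), [tuple of behead p.2]))).
  apply: measurableT_comp IH _; apply/measurable_fun_pairP; split => /=.
    apply: (measurableT_comp mf (g := fun p : Y * k.+1.-tuple S => (p.1, thead p.2))).
    apply/measurable_fun_pairP; split; first exact: measurable_fst.
    exact: measurableT_comp (@measurable_tnth _ S k.+1 ord0) measurable_snd.
  exact: measurableT_comp (@measurable_behead _ S k) measurable_snd.
by apply/funext => -[y t] /=; rewrite [in LHS](tuple_eta t).
Qed.

Lemma measurable_iter_update1 k y :
  measurable_fun [set: k.-tuple S] (fun t => iter_update f y t).
Proof.
have := measurableT_comp (@measurable_iter_update k) (pair1_measurable (T2 := k.-tuple S) y).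
exact.
Qed.

End tuple_measurable.

Section marginals.
Context d1 d2 (T1 : measurableType d1) (T2 : measurableType d2) (R : realType).
Variable m : {measure set (T1 * T2) -> \bar R}.

Definition fst_marginal : {measure set T1 -> \bar R}.
Proof. by refine (pushforward m fst); exact: measurable_fst. Defined.

Lemma fst_marginalE A : fst_marginal A = m (A `*` setT).
Proof. by rewrite setXT. Qed.

Definition swap_measure : {measure set (T2 * T1) -> \bar R}.
Proof. by refine (pushforward m (fun p => (p.2, p.1))); exact: measurable_swap. Defined.

Lemma swap_measureE F : swap_measure F = m [set p | F (p.2, p.1)].
Proof. by []. Qed.

End marginals.

Section consistency_deterministic.
Context (R : realType) dY dS dH (Y : measurableType dY) (S : measurableType dS)
  (H : measurableType dH).
Variables (gamma : R.-pker (Y * S) ~> Y) (f : Y * S -> Y) (psiH : R.-ker Y ~> H).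
Hypothesis gamma_det : forall y s B, measurable B -> gamma (y, s) B = \d_(f (y, s)) B.
Variables (psiSH : Y -> {measure set (H * S) -> \bar R})
  (psiS : Y -> {measure set S -> \bar R}).
Hypothesis consistent : forall y C A B, measurable C -> measurable A -> measurable B ->
  \int[psiSH y]_(p in C `*` A) gamma (y, p.2) B =
  \int[psiS y]_(s in A) \int[gamma (y, s)]_(y' in B) psiH y' C.

Lemma consistency_deterministic y C A : measurable C -> measurable A ->
  psiSH y (C `*` A) = \int[psiS y]_(s in A) psiH (f (y, s)) C.
Proof.
move=> mC mA.
transitivity (\int[psiSH y]_(p in C `*` A) gamma (y, p.2) setT).
  rewrite (eq_integral (cst 1)); last by move=> p _; rewrite prob_kernel.
  by rewrite integral_cst ?mul1e//; exact: measurableX.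
rewrite consistent//; apply: eq_integral => s _.
rewrite (eq_measure_integral (\d_(f (y, s)))); last by move=> U mU _; rewrite gamma_det.
by rewrite integral_dirac ?diracT ?mul1e//; exact: measurable_kernel.
Qed.

End consistency_deterministic.

Section filtering.
Context (R : realType) dY dS dH (Y : measurableType dY) (S : measurableType dS)
  (H : measurableType dH).
Variables (f : Y * S -> Y) (psiH : R.-pker Y ~> H) (kappa : R.-pker H ~> (H * S)%type).
Hypothesis mf : measurable_fun [set: Y * S] f.
Variables (psiSH : Y -> {measure set (H * S) -> \bar R})
  (psiS : Y -> {measure set S -> \bar R}).
Hypothesis psiSH_def : forall y E, measurable E -> psiSH y E = \int[psiH y]_h kappa h E.
Hypothesis psiS_def : forall y A, measurable A -> psiS y A = psiSH y ([set: H] `*` A).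
Hypothesis psiSH_rectangle : forall y C A, measurable C -> measurable A ->
  psiSH y (C `*` A) = \int[psiS y]_(s in A) psiH (f (y, s)) C.

Lemma xsection_measurable_psiS d (T : measurableType d) (g : T -> Y) :
  measurable_fun [set: T] g -> xsection_measurable (fun t => psiS (g t)).
Proof.
move=> mg F mF.
pose F' : set ((T * H) * (H * S)) := [set q | F (q.1.1, q.2.2)].
have mF' : measurable F'.
  apply: measurableT_preimage mF; apply/measurable_fun_pairP; split.
    exact: measurableT_comp measurable_fst measurable_fst.
  exact: measurableT_comp measurable_snd measurable_snd.
rewrite (_ : (fun t => _) = fun t => \int[psiH (g t)]_h kappa h (xsection F' (t, h))).
  apply: (measurable_fun_integral_xsection (xsection_measurable_comp psiH mg)
    (h := fun th => kappa th.2 (xsection F' th))).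
  - by move=> th; exact: measure_ge0.
  - exact: (xsection_measurable_comp kappa measurable_snd mF').
apply/funext => t; rewrite psiS_def; last exact: measurable_xsection.
rewrite psiSH_def; last by apply: measurableX => //; exact: measurable_xsection.
apply: eq_integral => h _; congr (kappa h _).
by apply/seteqP; split => -[h' s]; rewrite /xsection /= !inE /=; [case|split].
Qed.

Let measurable_update y : measurable_fun [set: S] (fun s => f (y, s)).
Proof. have := measurableT_comp mf (pair1_measurable (T2 := S) y); exact. Qed.

Let mupdate y := xsection_measurable_comp psiH (measurable_update y).

Lemma psiSH_swap_mixture y F : measurable F ->
  swap_measure (psiSH y) F = mixture (psiS y) (mupdate y) F.
Proof.
apply: eq_measure_rectangles => [|A B mA mB].
  rewrite swap_measureE (_ : [set _ | _] = setT)// psiSH_def//.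
  rewrite (eq_integral (cst 1)); last by move=> h _; rewrite prob_kernel.
  by rewrite integral_cst// mul1e prob_kernel ltry.
rewrite mixtureX// swap_measureE -psiSH_rectangle//.
by congr (psiSH y _); apply/seteqP; split => -[h s] [].
Qed.

Variables (psiSnH : forall k : nat, Y -> {measure set (k.-tuple S * H) -> \bar R})
  (y : Y).
Hypothesis psiSnH_0 : forall E, measurable E ->
  psiSnH 0%N y E = psiH y [set h | E ([tuple], h)].
Hypothesis psiSnH_S : forall k E, measurable E ->
  psiSnH k.+1 y E =
  \int[psiSnH k y]_p kappa p.2 [set q | E ([tuple of rcons p.1 q.2], q.1)].

Let marginal k := fst_marginal (psiSnH k y).
Let mhidden k := xsection_measurable_comp psiH (measurable_iter_update1 mf (k := k) y).
Let msignal k := xsection_measurable_psiS (measurable_iter_update1 mf (k := k) y).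

Lemma joint_law0_mixture E : measurable E ->
  psiSnH 0%N y E = mixture (marginal 0%N) (@mhidden 0%N) E.
Proof.
move=> mE; rewrite psiSnH_0// mixtureE.
rewrite (eq_integral (cst (psiH y (xsection E [tuple])))); last first.
  by move=> t _; rewrite (tuple0 t).
rewrite integral_cst// fst_marginalE setXTT psiSnH_0//.
rewrite (_ : [set h | [set: 0.-tuple S * H] ([tuple], h)] = setT)// prob_kernel mule1.
congr (psiH y _).
by apply/seteqP; split => h; rewrite /xsection /= inE.
Qed.

Section succ.
Variable k : nat.
Hypothesis joint_law_k : forall E, measurable E ->
  psiSnH k y E = mixture (marginal k) (@mhidden k) E.

Lemma joint_law_succ_iterated E : measurable E ->
  psiSnH k.+1 y E = \int[marginal k]_t \int[psiS (iter_update f y t)]_s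
    psiH (iter_update f y [tuple of rcons t s]) (xsection E [tuple of rcons t s]).
Proof.
move=> mE; rewrite psiSnH_S//.
pose next (pq : (k.-tuple S * H) * (H * S)) := ([tuple of rcons pq.1.1 pq.2.2], pq.2.1).
have mnext : measurable_fun [set: (k.-tuple S * H) * (H * S)] next.
  apply/measurable_fun_pairP; split; last first.
    exact: measurableT_comp measurable_fst measurable_snd.
  apply: (measurableT_comp (@measurable_rcons_tuple _ S k)
    (g := fun pq : (k.-tuple S * H) * (H * S) => (pq.1.1, pq.2.2))).
  apply/measurable_fun_pairP; split.
    exact: measurableT_comp measurable_fst measurable_fst.
  exact: measurableT_comp measurable_snd measurable_snd.
rewrite (eq_measure_integral (mixture (marginal k) (@mhidden k))); last first.
  by move=> A mA _; rewrite joint_law_k.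
rewrite integral_mixture//; last first.
  rewrite (_ : (fun p => _) = fun p => kappa p.2 (xsection (next @^-1` E) p)).
    exact: (xsection_measurable_comp kappa measurable_snd (measurableT_preimage mnext mE)).
  by apply/funext => p; congr (kappa _ _); apply/seteqP; split => q; rewrite /xsection /= inE.
apply: eq_integral => t _ /=.
pose F := (fun sh : S * H => ([tuple of rcons t sh.1], sh.2)) @^-1` E.
have mF : measurable F.
  apply: measurableT_preimage mE; apply/measurable_fun_pairP; split.
    exact: measurableT_comp (measurable_rcons_tuple1 t) measurable_fst.
  exact: measurable_snd.
rewrite -psiSH_def; last first.
  apply: (measurableT_preimage (g := fun q : H * S => (q.2, q.1))) mF.
  exact: measurable_swap.
rewrite -[X in psiSH _ X]/[set q | F (q.2, q.1)] -swap_measureE psiSH_swap_mixture//.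
rewrite mixtureE; apply: eq_integral => s _ /=; rewrite iter_update_rcons.
by congr (psiH _ _); apply/seteqP; split => h; rewrite /xsection /= !inE.
Qed.

Lemma marginal_succ A : measurable A ->
  marginal k.+1 A =
  mixture (marginal k) (@msignal k) ((fun p : k.-tuple S * S => [tuple of rcons p.1 p.2]) @^-1` A).
Proof.
move=> mA; rewrite fst_marginalE joint_law_succ_iterated; last exact: measurableX.
rewrite mixtureE; apply: eq_integral => t _.
have mAt : measurable (xsection ((fun p : k.-tuple S * S => [tuple of rcons p.1 p.2]) @^-1` A) t).
  apply: measurable_xsection; exact: measurableT_preimage (@measurable_rcons_tuple _ S k) mA.
rewrite -[X in psiS _ X]setIT -integral_indic//; apply: eq_integral => s _.
rewrite indicE mem_xsection.
have -> : ((t, s) \in (fun p : k.-tuple S * S => [tuple of rcons p.1 p.2]) @^-1` A) =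
    ([tuple of rcons t s] \in A) by apply/idP/idP; rewrite !in_setE.
have [sA|sA] := boolP ([tuple of rcons t s] \in A).
  by rewrite in_xsectionX// prob_kernel.
by rewrite notin_xsectionX// measure0.
Qed.

Lemma joint_law_succ E : measurable E ->
  psiSnH k.+1 y E = mixture (marginal k.+1) (@mhidden k.+1) E.
Proof.
move=> mE; have mhE := @mhidden k.+1 _ mE.
rewrite joint_law_succ_iterated// mixtureE.
rewrite (ge0_integral_image (@measurable_rcons_tuple _ S k) marginal_succ)//.
rewrite integral_mixture//.
exact: measurableT_comp mhE (@measurable_rcons_tuple _ S k).
Qed.

End succ.

Lemma joint_law_mixture k E : measurable E ->
  psiSnH k y E = mixture (marginal k) (@mhidden k) E.
Proof.
elim: k E => [|k IH] E mE; first exact: joint_law0_mixture.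
exact: joint_law_succ.
Qed.

End filtering.

Unset Implicit Arguments.
Theorem mainTheorem2
  (R : realType) (dY dS dH : measure_display)
  (Y : measurableType dY) (S : measurableType dS) (H : measurableType dH)
  (* the machine (Y,S,gamma), deterministic with update function f *)
  (gamma : R.-pker (Y * S) ~> Y) (f : Y * S -> Y)
  (mf : measurable_fun [set: Y * S] f)
  (gamma_det : forall (y : Y) (s : S) (B : set Y), measurable B ->
     gamma (y, s) B = \d_(f (y, s)) B)
  (* the interpretation (H, psiH, kappa) *)
  (psiH : R.-pker Y ~> H) (kappa : R.-pker H ~> (H * S)%type)
  (* psi_{S,H'} and psi_S *)
  (psiSH : Y -> {measure set (H * S) -> \bar R})
  (psiSH_def : forall (y : Y) (E : set (H * S)), measurable E ->
     psiSH y E = \int[psiH y]_h kappa h E)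
  (psiS : Y -> {measure set S -> \bar R})
  (psiS_def : forall (y : Y) (A : set S), measurable A ->
     psiS y A = psiSH y ([set: H] `*` A))
  (* consistency of the Bayesian filtering interpretation *)
  (consistent : forall (y : Y) (C : set H) (A : set S) (B : set Y),
     measurable C -> measurable A -> measurable B ->
     \int[psiSH y]_(p in C `*` A) gamma (y, p.2) B =
     \int[psiS y]_(s in A) \int[gamma (y, s)]_(y' in B) psiH y' C)
  (* the joint laws psi_{S^k,H_k} of ((s_1,...,s_k), h_k) *)
  (psiSnH : forall k : nat, Y -> {measure set (k.-tuple S * H) -> \bar R})
  (psiSnH_0 : forall (y : Y) (E : set (0.-tuple S * H)), measurable E ->
     psiSnH 0%N y E = psiH y [set h | E ([tuple], h)])
  (psiSnH_S : forall (k : nat) (y : Y) (E : set (k.+1.-tuple S * H)),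
     measurable E ->
     psiSnH k.+1 y E =
     \int[psiSnH k y]_p kappa p.2 [set q | E ([tuple of rcons p.1 q.2], q.1)])
  (n : nat) (n_ge1 : (0 < n)%N)
  (* the marginal psi_{S^n} *)
  (psiSn : Y -> {measure set (n.-tuple S) -> \bar R})
  (psiSn_def : forall (y : Y) (A : set (n.-tuple S)), measurable A ->
     psiSn y A = psiSnH n y (A `*` [set: H])) :
  forall (y : Y) (A : set (n.-tuple S)) (C : set H),
    measurable A -> measurable C ->
    psiSnH n y (A `*` C) =
    \int[psiSn y]_(ss in A) psiH (iter_update f y (tval ss)) C.
Proof.
move=> y A C mA mC.
have rect := consistency_deterministic gamma_det consistent.
rewrite (joint_law_mixture mf psiSH_def psiS_def rect (psiSnH_0 y) (psiSnH_S ^~ y));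
  last exact: measurableX.
rewrite mixtureX//; apply: eq_measure_integral => B mB _.
by rewrite fst_marginalE psiSn_def.
Qed.
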